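(* Let $G$ be a connected graph with $n\ge 2$ vertices and $m$ edges. Denote the orbits of the action of $\mathrm{Aut}(G)$ on $E(G)$ by $E_1,E_2,\ldots,E_l$, and for each $1\le i\le l$ let $e_i=u_iv_i$ be a fixed edge in the orbit $E_i$. Then $$HS(G)=\sum_{i=1}^{l}\frac{2|E_i|}{\sigma(u_i)+\sigma(v_i)},\qquad SJ(G)=\frac{m}{m-n+2}\sum_{i=1}^{l}\frac{|E_i|}{\sqrt{\sigma(u_i)+\sigma(v_i)}},$$ $$GAS(G)=\frac{n}{2m}\sum_{i=1}^{l}\frac{2|E_i|\sqrt{\sigma(u_i)\sigma(v_i)}}{\sigma(u_i)+\sigma(v_i)},\qquad \mathrm{irr}_{\mathrm{Tr}}(G)=\sum_{i=1}^{l}|E_i|\,|\sigma(u_i)-\sigma(v_i)|,$$ $$MS_1(G)=\sum_{i=1}^{l}|E_i|(\sigma(u_i)+\sigma(v_i)),\qquad MS_2(G)=\sum_{i=1}^{l}|E_i|\,\sigma(u_i)\sigma(v_i).$$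
   Context: All graphs are finite and simple. For a connected graph $G$ with $n$ vertices and $m$ edges, $d(u,v)$ is the graph distance and the transmission of a vertex $v$ is $\sigma(v)=\sum_{u\in V(G)}d(v,u)$. $\mathrm{Aut}(G)$ is the group of automorphisms of $G$, acting on $E(G)$ by $uv\mapsto \alpha(u)\alpha(v)$. The indices are defined by $$HS(G)=\sum_{uv\in E(G)}\frac{2}{\sigma(u)+\sigma(v)},\qquad SJ(G)=\frac{m}{m-n+2}\sum_{uv\in E(G)}\frac{1}{\sqrt{\sigma(u)+\sigma(v)}},$$ $$GAS(G)=\frac{n}{2m}\sum_{uv\in E(G)}\frac{2\sqrt{\sigma(u)\sigma(v)}}{\sigma(u)+\sigma(v)},\qquad \mathrm{irr}_{\mathrm{Tr}}(G)=\sum_{uv\in E(G)}|\sigma(u)-\sigma(v)|,$$ $$MS_1(G)=\sum_{uv\in E(G)}(\sigma(u)+\sigma(v)),\qquad MS_2(G)=\sum_{uv\in E(G)}\sigma(u)\sigma(v).$$ *)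

(* Defs.v *)
From HB Require Import structures.
From mathcomp Require Import all_boot all_order all_algebra all_fingroup.

Set Implicit Arguments.
Unset Strict Implicit.
Unset Printing Implicit Defensive.

Import Order.TTheory GRing.Theory Num.Theory.
Local Open Scope ring_scope.

(* A finite simple graph is a symmetric irreflexive relation e on a finType;
   an edge uv is the two-element set [set u; v]. *)

Section Graph.
Variables (T : finType) (e : rel T).

Definition edges : {set {set T}} :=
  [set [set p.1; p.2] | p : T * T & e p.1 p.2].

Definition connected_graph : Prop := forall x y : T, connect e x y.

Definition has_path (x y : T) (k : nat) : bool :=
  [exists p : k.-tuple T, [&& path e x p, uniq (x :: p) & last x p == y]].

Lemma has_path_ex (x y : T) : connect e x y -> exists k, has_path x y k.
Proof.
case/connectP=> p ep ->; case/shortenP: ep => q eq uq _.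
by exists (size q); apply/existsP; exists (in_tuple q); rewrite eq uq eqxx.
Qed.

(* Vertices in different components get the junk value 0. *)
Definition dist (x y : T) : nat :=
  match @idP (connect e x y) with
  | ReflectT xy => ex_minn (has_path_ex xy)
  | ReflectF _ => 0%N
  end.

Definition transmission (v : T) : nat := (\sum_(u : T) dist v u)%N.

Definition graph_aut : {set {perm T}} :=
  [set s : {perm T} | [forall x, forall y, e (s x) (s y) == e x y]].

Lemma graph_autP (s : {perm T}) :
  reflect (forall x y, e (s x) (s y) = e x y) (s \in graph_aut).
Proof.
rewrite inE; apply: (iffP forallP) => [h x y|h x].
  exact/eqP/(forallP (h x)).
by apply/forallP => y; rewrite h.
Qed.

Lemma graph_aut_group_set : group_set graph_aut.
Proof.
apply/group_setP; split=> [|s t /graph_autP hs /graph_autP ht].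
  by apply/graph_autP => x y; rewrite !perm1.
by apply/graph_autP => x y; rewrite !permM ht hs.
Qed.
Canonical graph_aut_group := Group graph_aut_group_set.

(* 'P^* maps [set u; v] to [set s u; s v]. *)
Definition edge_orbits : {set {set {set T}}} :=
  [set orbit 'P^* graph_aut a | a in edges].

Section Indices.
Variable R : rcfType.

(* The value f u v at the edge a = uv, computed at some choice of endpoints;
   the choice is immaterial when f is symmetric (edge_valE). *)
Definition edge_val (f : T -> T -> R) (a : {set T}) : R :=
  if [pick p : T * T | a == [set p.1; p.2]] is Some p then f p.1 p.2 else 0.

Lemma edge_valE (f : T -> T -> R) (u v : T) :
  (forall x y, f x y = f y x) -> edge_val f [set u; v] = f u v.
Proof.
move=> fC; rewrite /edge_val; case: pickP => [[x y] /= /eqP E|/(_ (u, v))];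
  last by rewrite eqxx.
have ux : u \in [set x; y] by rewrite -E set21.
have vx : v \in [set x; y] by rewrite -E set22.
have xu : x \in [set u; v] by rewrite E set21.
have yu : y \in [set u; v] by rewrite E set22.
move: ux vx xu yu; rewrite !inE.
by do 4![case/orP=> /eqP ?]; subst=> //; apply: fC.
Qed.

Definition edge_sum (f : T -> T -> R) : R := \sum_(a in edges) edge_val f a.

Definition sigma (v : T) : R := (transmission v)%:R.

Definition HS : R := edge_sum (fun u v => 2 / (sigma u + sigma v)).

Definition SJ : R :=
  #|edges|%:R / (#|edges|%:R - #|T|%:R + 2) *
  edge_sum (fun u v => 1 / Num.sqrt (sigma u + sigma v)).

Definition GAS : R :=
  #|T|%:R / (2 * #|edges|%:R) *
  edge_sum (fun u v =>
    2 * Num.sqrt (sigma u * sigma v) / (sigma u + sigma v)).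

Definition irr_Tr : R := edge_sum (fun u v => `|sigma u - sigma v|).

Definition MS1 : R := edge_sum (fun u v => sigma u + sigma v).

Definition MS2 : R := edge_sum (fun u v => sigma u * sigma v).

End Indices.
End Graph.

Arguments sigma {T} e R v.
Arguments HS {T} e R.
Arguments SJ {T} e R.
Arguments GAS {T} e R.
Arguments irr_Tr {T} e R.
Arguments MS1 {T} e R.
Arguments MS2 {T} e R.

(* Main.v *)
Require Import Defs.
From HB Require Import structures.
From mathcomp Require Import all_boot all_order all_algebra all_fingroup.

(** Each of the six indices is, up to a prefactor depending only on the numbers
of vertices and edges, a sum over the edges uv of f(u, v), where f is symmetric
and depends on u and v only through their transmissions. An automorphism s
carries the simple paths from x to y bijectively, and length for length, onto
those from s x to s y, so it preserves distances ([dist_aut]); since it also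
permutes the vertices, it preserves transmissions ([transmission_aut]). The
summand is therefore constant on every orbit of edges ([edge_val_orbit]). The
orbits partition the edge set ([edge_orbits_partition]), so collecting the sum
orbit by orbit gives the term |E_i| f(u_i, v_i) for the orbit E_i
([edge_sum_orbits]), and the six formulas are instances of this identity. *)

Set Implicit Arguments.
Unset Strict Implicit.
Unset Printing Implicit Defensive.

Import Order.TTheory GRing.Theory Num.Theory.
Local Open Scope ring_scope.

Section AutomorphismPath.
Variables (T : finType) (e : rel T) (s : {perm T}).
Hypothesis s_aut : s \in graph_aut e.

Lemma path_aut x p : path e (s x) (map s p) = path e x p.
Proof.
rewrite path_map; apply: eq_path => y z; exact: (graph_autP _ _ s_aut).
Qed.

Lemma has_path_aut_imp x y k : has_path e x y k -> has_path e (s x) (s y) k.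
Proof.
case/existsP=> p /and3P[ep up /eqP <-]; apply/existsP; exists (map_tuple s p).
rewrite path_aut ep -[s x :: _]/(map s (x :: p)) (map_inj_uniq perm_inj) up.
by rewrite last_map eqxx.
Qed.

End AutomorphismPath.

Section Transmission.
Variables (T : finType) (e : rel T) (s : {perm T}).
Hypothesis s_aut : s \in graph_aut e.

Lemma has_path_aut x y k : has_path e (s x) (s y) k = has_path e x y k.
Proof.
apply/idP/idP; last exact: has_path_aut_imp.
(* The converse implication is the direct one applied to the inverse of s. *)
by move/(has_path_aut_imp (groupVr s_aut)); rewrite !permK.
Qed.

Lemma has_path_connect x y k : has_path e x y k -> connect e x y.
Proof. by case/existsP=> p /and3P[ep _ /eqP <-]; apply/connectP; exists p. Qed.

(** A distance is the least length of a simple path, and the two pairs of points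
are joined by simple paths of the same lengths. *)
Lemma dist_aut x y : dist e (s x) (s y) = dist e x y.
Proof.
rewrite /dist.
case: {-}_ / idP => [c|nc]; case: {-}_ / idP => [c'|nc'] //.
- case: ex_minnP => k; rewrite has_path_aut => pk kmin.
  case: ex_minnP => k' pk' kmin'; apply/eqP; rewrite eqn_leq kmin' // andbT.
  by apply: kmin; rewrite has_path_aut.
(* Automorphisms preserve the components, so the two cases in which only one
   of the two distances is the junk value do not occur. *)
- have [k] := has_path_ex c.
  by rewrite has_path_aut => /has_path_connect.
- have [k] := has_path_ex c'.
  by rewrite -has_path_aut => /has_path_connect.
Qed.

(** The vertices, hence the terms of the sum of distances, are only permuted. *)
Lemma transmission_aut x : transmission e (s x) = transmission e x.
Proof.
rewrite /transmission (reindex_perm s).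
by apply: eq_bigr => y _; rewrite dist_aut.
Qed.

Lemma sigma_aut (R : rcfType) x : sigma e R (s x) = sigma e R x.
Proof. by rewrite /sigma transmission_aut. Qed.

End Transmission.

Lemma setact_set2 (T : finType) (s : {perm T}) (x y : T) :
  ('P^*)%act [set x; y] s = [set s x; s y].
Proof. by rewrite /= setactE imsetU1 !imset_set1. Qed.

Lemma mem_edges_act (T : finType) (e : rel T) (s : {perm T}) (a : {set T}) :
  s \in graph_aut e -> a \in edges e -> ('P^*)%act a s \in edges e.
Proof.
move=> s_aut /imsetP[[x y]]; rewrite inE /= => exy ->; rewrite setact_set2.
by apply/imsetP; exists (s x, s y); rewrite // inE /= (graph_autP _ _ s_aut).
Qed.

Lemma edge_orbits_partition (T : finType) (e : rel T) :
  partition (edge_orbits e) (edges e).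
Proof.
apply: orbit_partition; apply/actsP => s s_aut a.
apply/idP/idP; last exact: mem_edges_act.
by move/(mem_edges_act (groupVr s_aut)); rewrite actK.
Qed.

Section OrbitSum.
Variables (T : finType) (e : rel T) (R : rcfType) (f : T -> T -> R).
Hypothesis f_sym : forall x y, f x y = f y x.
Hypothesis f_aut :
  forall s, s \in graph_aut e -> forall x y, f (s x) (s y) = f x y.

(** [edge_val] picks the endpoints of an edge in an uncontrolled order, so the
symmetry of f is needed to compare it with f at the images of x and y. *)
Lemma edge_val_orbit A x y a :
  A \in edge_orbits e -> [set x; y] \in A -> a \in A -> edge_val f a = f x y.
Proof.
case/imsetP=> b _ -> xyb ab.
(* Orbits are equivalence classes, so a is a translate of xy itself and not
   just of the common base edge b. *)
have /orbitP[s s_aut <-]: a \in orbit 'P^* (graph_aut e) [set x; y].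
  by apply: orbit_trans ab _; rewrite orbit_sym.
by rewrite setact_set2 edge_valE // f_aut.
Qed.

(** The general form of the six formulas: since [edge_val_orbit] makes the
summand constant on each orbit, an orbit contributes its size times the value
at any representative. *)
Lemma edge_sum_orbits (l : nat) (E : 'I_l -> {set {set T}}) (u v : 'I_l -> T) :
    injective E -> [set E i | i : 'I_l] = edge_orbits e ->
    (forall i, [set u i; v i] \in E i) ->
  edge_sum e f = \sum_(i < l) #|E i|%:R * f (u i) (v i).
Proof.
move=> E_inj E_orb uvE; rewrite /edge_sum.
have /and3P[/eqP <- tI _] := edge_orbits_partition e.
rewrite big_trivIset //= -E_orb big_imset /=; last by move=> i j _ _ /E_inj.
apply: eq_bigr => i _; rewrite mulr_natl -sumr_const; apply: eq_bigr => a.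
by apply: edge_val_orbit; rewrite ?uvE // -E_orb imset_f.
Qed.

End OrbitSum.

Theorem theorem3 (R : rcfType) (T : finType) (e : rel T)
    (e_sym : symmetric e) (e_irr : irreflexive e)
    (e_conn : connected_graph e)
    (n m : nat) (n_def : n = #|T|) (m_def : m = #|edges e|)
    (n_ge2 : (2 <= n)%N)
    (l : nat) (E : 'I_l -> {set {set T}})
    (E_inj : injective E)
    (E_orbits : [set E i | i : 'I_l] = edge_orbits e)
    (u v : 'I_l -> T) (uv_E : forall i : 'I_l, [set u i; v i] \in E i) :
  let s := sigma e R in
  HS e R = \sum_(i < l) 2 * #|E i|%:R / (s (u i) + s (v i))
  /\ SJ e R = m%:R / (m%:R - n%:R + 2) *
       \sum_(i < l) #|E i|%:R / Num.sqrt (s (u i) + s (v i))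
  /\ GAS e R = n%:R / (2 * m%:R) *
       \sum_(i < l) 2 * #|E i|%:R * Num.sqrt (s (u i) * s (v i))
                      / (s (u i) + s (v i))
  /\ irr_Tr e R = \sum_(i < l) #|E i|%:R * `|s (u i) - s (v i)|
  /\ MS1 e R = \sum_(i < l) #|E i|%:R * (s (u i) + s (v i))
  /\ MS2 e R = \sum_(i < l) #|E i|%:R * (s (u i) * s (v i)).
Proof.
move=> s; subst n m.
have sE t x : t \in graph_aut e -> s (t x) = s x by move/sigma_aut; apply.
have orbits_sum (g : R -> R -> R) (g_sym : forall a b : R, g a b = g b a) :
      edge_sum e (fun x y => g (s x) (s y)) =
      \sum_(i < l) #|E i|%:R * g (s (u i)) (s (v i)).
  by apply: edge_sum_orbits => // t t_aut x y; rewrite !sE.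
split.
  rewrite [LHS](orbits_sum (fun a b => 2 / (a + b))).
    by apply: eq_bigr => i _; rewrite mulrCA mulrA.
  by move=> a b; rewrite addrC.
split.
  congr (_ * _).
  rewrite (orbits_sum (fun a b => 1 / Num.sqrt (a + b))).
    by apply: eq_bigr => i _; rewrite mul1r.
  by move=> a b; rewrite addrC.
split.
  congr (_ * _).
  rewrite (orbits_sum (fun a b => 2 * Num.sqrt (a * b) / (a + b))).
    by apply: eq_bigr => i _; rewrite !mulrA [_ * 2]mulrC.
  by move=> a b; rewrite addrC [b * a]mulrC.
split; first by apply: (orbits_sum (fun a b => `|a - b|)); apply: distrC.
split; first by apply: (orbits_sum (fun a b => a + b)); apply: addrC.
by apply: (orbits_sum (fun a b => a * b)); apply: mulrC.
Qed.
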